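(* Let $\varepsilon>0$. Assume that the mesh is such that for any $i\in\{1,\dots,M_h\}$ there exist $k\in\{M_h+1,\dots,N_h\}$ and $i_1,i_2,\dots,i_l\in\{1,\dots,M_h\}$ such that all these indices are mutually different and $$a_{ii_1}^D\ne0,\quad a_{i_1i_2}^D\ne0,\quad\dots,\quad a_{i_{l-1}i_l}^D\ne0,\quad a_{i_lk}^D\ne0.$$ Let $u=(u_1,\dots,u_{N_h})^\top\in\mathbb{R}^{N_h}$ be a solution of the nonlinear WMC problem, i.e. $$a_i^Ru_i-\sum_{j\in\mathcal N_i\setminus\{i\}}\big[2d_{ij}(\bar u_{ij}^{s,*}-u_i)-a_{ij}^D(u_j-u_i)\big]=0\quad (i=1,\dots,M_h),\qquad u_i=u_D(\mathbf{x}_i)\quad (i=M_h+1,\dots,N_h).$$ Then the following global discrete maximum principles hold: $$b_i\le0,\ i=1,\dots,M_h\ \Rightarrow\ \max_{i=1,\dots,N_h}u_i\le\max_{i=M_h+1,\dots,N_h}u_i^+,$$ $$b_i\ge0,\ i=1,\dots,M_h\ \Rightarrow\ \min_{i=1,\dots,N_h}u_i\ge\min_{i=M_h+1,\dots,N_h}u_i^-,$$ where $u_i^+=\max\{u_i,0\}$ and $u_i^-=\min\{u_i,0\}$. If $c=0$ in $\Omega$, then the following stronger global discrete maximum principles hold: $$b_i\le0,\ i=1,\dots,M_h\ \Rightarrow\ \max_{i=1,\dots,N_h}u_i=\max_{i=M_h+1,\dots,N_h}u_i,$$ $$b_i\ge0,\ i=1,\dots,M_h\ \Rightarrow\ \m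in_{i=1,\dots,N_h}u_i=\min_{i=M_h+1,\dots,N_h}u_i.$$
   Context: **Problem data.** $d\in\{1,2,3\}$; $\Omega\subset\mathbb{R}^d$ is a bounded polytopal domain with Lipschitz boundary $\Gamma=\partial\Omega$. The continuous problem is $-\varepsilon\Delta u+\mathbf{v}\cdot\nabla u+cu=f$ in $\Omega$, $u=u_D$ on $\Gamma_D$, with constant $\varepsilon$, velocity field $\mathbf{v}:\overline\Omega\to\mathbb{R}^d$, $c\ge 0$, source $f$, and Dirichlet data $u_D$. For $\varepsilon>0$ one has $\Gamma_D=\Gamma$. The data $\mathbf{v},c,f$ (on $\overline\Omega$) and $u_D$ (on $\Gamma_D$) are continuous. **Mesh and finite elements.** $\mathcal T_h$ is a conforming simplex mesh with $\bigcup_{K\in\mathcal T_h}K=\overline\Omega$, vertices $\mathbf{x}_1,\dots,\mathbf{x}_{N_h}$, maximal cell diameter $h>0$. $\varphi_j\in C(\overline\Omega)$ are the piecewise linear Lagrange basis functions, $\varphi_j|_K\in\mathbb{P}_1(K)$ for all $K\in\mathcal T_h$, $\varphi_j(\mathbf{x}_i)=\delta_{ij}$. A vector $u=(u_1,\dots,u_{N_h})^\top$ is identified with $u_h=\sum_{j=1}^{N_h}u_j\varphi_j$. The vertices lying on the Dirichlet boundary are exactly those with indices $M_h+1,\dots,N_h$. $\mathcal N_i$ is the set of indices $j$ such that $\varphi_i,\varphi_j$ have overlapping supports, i.e. $\mathbf{x}_i,\mathbf{x}_j$ belong to a common mesh cell (so $i\in\mathcal N_i$). **Matrices.** $a_{ij}^D=\varepsilon\int_\Omega\nabla\varphi_i\cdot\nabla\varphi_j\,d\mathbf{x}$,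 $a_{ij}^C=\int_\Omega\varphi_i\,\mathbf{v}\cdot\nabla\varphi_j\,d\mathbf{x}$, $a_{ij}^R=\int_\Omega c\,\varphi_i\varphi_j\,d\mathbf{x}$, $b_i=\int_\Omega\varphi_i f\,d\mathbf{x}$, $a_i^R=\sum_{j\in\mathcal N_i}a_{ij}^R$. With a fixed constant $\delta>0$, for $j\in\mathcal N_i\setminus\{i\}$: $d_{ij}=\max\{|a_{ij}^C|,\delta h^{d-1},|a_{ji}^C|\}$ (and $d_{ij}=0$ if $j\notin\mathcal N_i$, $d_{ii}=-\sum_{k\in\mathcal N_i\setminus\{i\}}d_{ik}$); $a_i^C=\sum_{j\in\mathcal N_i\setminus\{i\}}2d_{ij}>0$. **Standing assumptions.** $a_{ij}^D\le 0$ for all $i\ne j$ in $\{1,\dots,N_h\}$; $|\mathbf{v}(\mathbf{x}_i)|+|\mathbf{v}(\mathbf{x}_j)|>0$ for all $i$ and $j\in\mathcal N_i\setminus\{i\}$ ($|\cdot|$ Euclidean norm). **Well-balanced (WMC) scheme.** All following quantities are functions of $u\in\mathbb{R}^{N_h}$. For $i=1,\dots,N_h$ and $j\in\mathcal N_i\setminus\{i\}$, with $s_i=f(\mathbf{x}_i)-c(\mathbf{x}_i)u_i$, $$\bar u_{ij}=\frac{u_j+u_i}{2}-\frac{a_{ij}^C(u_j-u_i)}{2d_{ij}},\qquad P_{ij}=\frac12\,\frac{s_i+s_j}{2}\,\frac{(\mathbf{x}_i-\mathbf{x}_j)\cdot(\mathbf{v}(\mathbf{x}_i)+\mathbf{v}(\mathbf{x}_j))}{2(\max\{|\mathbf{v}(\mathbf{x}_i)|,|\mathbf{v}(\mathbf{x}_j)|\})^2}.$$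 For $i\le M_h$, $j\in\mathcal N_i\setminus\{i\}$, fix a mesh cell $K_j^i$ containing $\mathbf{x}_i$ that is intersected by the half line $\{\mathbf{x}_i+\theta(\mathbf{x}_i-\mathbf{x}_j):\theta>0\}$, and set $u_j^i=u_i+\nabla u_h|_{K_j^i}\cdot(\mathbf{x}_i-\mathbf{x}_j)$. Define, for $i\le M_h$, $$Q_{ij}^+=\max\Big\{\tfrac{u_j^i-u_i}{2},\max\{u_i,u_j\}-\bar u_{ij}-\tfrac{b_i}{a_i^C}\Big\},\quad Q_{ij}^-=\min\Big\{\tfrac{u_j^i-u_i}{2},\min\{u_i,u_j\}-\bar u_{ij}-\tfrac{b_i}{a_i^C}\Big\},$$ $R_{ij}=Q_{ij}^+/P_{ij}$ if $b_i\le0$ and $P_{ij}>Q_{ij}^+$; $R_{ij}=Q_{ij}^-/P_{ij}$ if $b_i\ge0$ and $P_{ij}<Q_{ij}^-$; $R_{ij}=1$ otherwise. For $i>M_h$, $R_{ij}=1$. Set $\alpha_{ij}=\min\{R_{ij},R_{ji}\}$. For $i\le M_h$, $j\in\mathcal N_i\setminus\{i\}$: $$\bar u_{ij}^s=\bar u_{ij}+\alpha_{ij}P_{ij}+\frac{b_i}{a_i^C},\qquad f_{ij}^s=2d_{ij}\Big[\frac{u_i-u_j}{2}-\alpha_{ij}P_{ij}\Big]+a_{ij}^R(u_i-u_j),$$ $\bar u_i^{\min}=\min_{j\in\mathcal N_i\setminus\{i\}}\bar u_{ij}^s$, $\bar u_i^{\max}=\max_{j\in\mathcal N_i\setminus\{i\}}\bar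 u_{ij}^s$. The limited fluxes are: $f_{ij}^{s,*}=0$ if $f_{ij}^s=0$; if $i,j\le M_h$, $$f_{ij}^{s,*}=\begin{cases}\min\{f_{ij}^s,\,2d_{ij}(\bar u_i^{\max}-\bar u_{ij}^s),\,2d_{ij}(\bar u_{ji}^s-\bar u_j^{\min})\}& f_{ij}^s>0,\\ \max\{f_{ij}^s,\,2d_{ij}(\bar u_i^{\min}-\bar u_{ij}^s),\,2d_{ij}(\bar u_{ji}^s-\bar u_j^{\max})\}& f_{ij}^s<0,\end{cases}$$ and if $i\le M_h<j$, $$f_{ij}^{s,*}=\begin{cases}\min\{f_{ij}^s,\,2d_{ij}(\bar u_i^{\max}-\bar u_{ij}^s)\}& f_{ij}^s>0,\\ \max\{f_{ij}^s,\,2d_{ij}(\bar u_i^{\min}-\bar u_{ij}^s)\}& f_{ij}^s<0.\end{cases}$$ Finally $\bar u_{ij}^{s,*}=\bar u_{ij}^s+f_{ij}^{s,*}/(2d_{ij})$. *)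

(* Defs.v *)
(* Points of R^d are row vectors 'rV[R]_d.  Indices of vertices are the ordinals of 'I_N, so that
   the 1-based index ranges {1..Mh} and {Mh+1..N} read (i < Mh) and (Mh <= i). *)
From HB Require Import structures.
From mathcomp Require Import all_boot all_order all_algebra.
From mathcomp Require Import all_classical all_reals all_analysis.
Set Implicit Arguments.
Unset Strict Implicit.
Unset Printing Implicit Defensive.
Import Order.TTheory GRing.Theory Num.Theory.
Import numFieldNormedType.Exports.
Local Open Scope classical_set_scope.
Local Open Scope ring_scope.

(* Maximum and minimum of finitely many reals; 0 for an empty range. *)
Definition fmax (R : realType) (I : finType) (P : pred I) (F : I -> R) : R :=
  if [pick i | P i] is Some i0 then \big[Num.max/F i0]_(i | P i) F i else 0.

Definition fmin (R : realType) (I : finType) (P : pred I) (F : I -> R) : R :=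
  if [pick i | P i] is Some i0 then \big[Num.min/F i0]_(i | P i) F i else 0.

(* The norm that the library puts on 'rV[R]_d is the sup norm; it induces the
   usual topology, but |.| below always means the Euclidean norm enorm. *)
Definition dot (R : realType) (d : nat) (u v : 'rV[R]_d) : R :=
  \sum_(k < d) u ord0 k * v ord0 k.

Definition enorm (R : realType) (d : nat) (u : 'rV[R]_d) : R :=
  Num.sqrt (dot u u).

Definition diameter (R : realType) (d : nat) (A : set 'rV[R]_d) : R :=
  sup [set enorm (y - z) | y in A & z in A].

(* Lebesgue integral over R^d, as an iterated one-dimensional Lebesgue
   integral.  It is only applied to bounded Borel functions with bounded
   support, for which the two agree by Fubini's theorem. *)
Fixpoint integral_Rd (R : realType) (d : nat) : ('rV[R]_d -> R) -> R :=
  match d with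
  | 0 => fun F => F 0
  | d'.+1 => fun F =>
      (\int[lebesgue_measure]_(t in [set: R])
         integral_Rd (fun y : 'rV[R]_d' =>
           F (row_mx (t%:M : 'M[R]_1) y : 'rV[R]_(1 + d'))))%R
  end.

Definition integral_on (R : realType) (d : nat) (A : set 'rV[R]_d)
    (F : 'rV[R]_d -> R) : R :=
  integral_Rd (fun y => F y * \1_A y).

Definition bnd (R : realType) (d : nat) (A : set 'rV[R]_d) : set 'rV[R]_d :=
  closure A `\` interior A.

(* Near each boundary point, A is the strict epigraph, in some direction e, of
   a Lipschitz function of the d - 1 coordinates orthogonal to e; such a
   function is represented by a g : R^d -> R that is constant along e. *)
Definition lipschitz_boundary (R : realType) (d : nat) (A : set 'rV[R]_d) :=
  forall p, bnd A p ->
  exists (e : 'rV[R]_d) (g : 'rV[R]_d -> R) (L : R) (U : set 'rV[R]_d),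
    [/\ enorm e = 1,
        forall y t, g (y + t *: e) = g y,
        forall y z, `|g y - g z| <= L * enorm (y - z),
        open_nbhs p U
      & A `&` U = [set y | g y < dot e y] `&` U].

(* "Polytopal" is not repeated here: conforming_mesh makes the closure of the
   domain a finite union of nondegenerate simplices. *)
Definition bounded_lipschitz_domain (R : realType) (d : nat)
    (A : set 'rV[R]_d) :=
  [/\ open A, A !=set0, connected A, bounded_set A & lipschitz_boundary A].

(* A cell is given by the set of indices of its vertices. *)
Record wmc_data (R : realType) (d N : nat) := WmcData {
  Omega : set 'rV[R]_d;
  eps : R;                          (* diffusion coefficient *)
  vel : 'rV[R]_d -> 'rV[R]_d;       (* velocity field v *)
  reac : 'rV[R]_d -> R;             (* reaction coefficient c *)
  src : 'rV[R]_d -> R;              (* right-hand side f *)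
  uD : 'rV[R]_d -> R;               (* Dirichlet data *)
  vertex : 'I_N -> 'rV[R]_d;
  cells : {set {set 'I_N}};
  Mh : nat;                         (* number of non-Dirichlet vertices *)
  phi : 'I_N -> 'rV[R]_d -> R;      (* Lagrange basis functions *)
  delta : R;
  upwind : 'I_N -> 'I_N -> {set 'I_N}  (* the cell K_j^i is upwind i j *)
}.

Section Mesh.
Variables (R : realType) (d N : nat) (D : wmc_data R d N).
Local Notation x := (vertex D).

Definition simplex (K : {set 'I_N}) : set 'rV[R]_d :=
  [set y | exists w : 'I_N -> R,
     [/\ forall i, i \in K -> 0 <= w i,
         \sum_(i in K) w i = 1
       & y = \sum_(i in K) w i *: x i]].

Definition affinely_independent (K : {set 'I_N}) :=
  forall w : 'I_N -> R,
    \sum_(i in K) w i = 0 -> \sum_(i in K) w i *: x i = 0 ->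
    forall i, i \in K -> w i = 0.

Definition conforming_mesh :=
  [/\ injective x,
      forall i, exists2 K, K \in cells D & i \in K,
      forall K, K \in cells D -> #|K| = d.+1 /\ affinely_independent K,
      \bigcup_(K in [set` cells D]) simplex K = closure (Omega D)
    & forall K L, K \in cells D -> L \in cells D ->
        simplex K `&` simplex L = simplex (K :&: L)].

Definition mesh_size : R :=
  fmax (fun K => K \in cells D) (fun K => diameter (simplex K)).

Definition P1_on (K : {set 'I_N}) (F : 'rV[R]_d -> R) :=
  exists (g : 'rV[R]_d) (b : R), forall y, simplex K y -> F y = dot g y + b.

Definition lagrange_basis :=
  forall j, [/\ {within closure (Omega D), continuous (phi D j)},
                forall K, K \in cells D -> P1_on K (phi D j)
              & forall i, phi D j (x i) = (i == j)%:R].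

(* Gradient of F|_K for F affine on a cell K: the unique vector g below. *)
Definition grad_on (K : {set 'I_N}) (F : 'rV[R]_d -> R) : 'rV[R]_d :=
  xget 0 [set g | forall y z, simplex K y -> simplex K z ->
                    F z - F y = dot g (z - y)].

(* Gradient of a continuous piecewise affine function, defined almost
   everywhere; where several cells meet (a null set), the gradient on one of
   them is taken. *)
Definition grad (F : 'rV[R]_d -> R) (y : 'rV[R]_d) : 'rV[R]_d :=
  if [pick K in cells D | y \in simplex K] is Some K then grad_on K F else 0.

(* j \in N_i, resp. j \in N_i \ {i}; as the mesh is conforming, the vertex x i
   lies in the cell K exactly when i \in K. *)
Definition nbr (i j : 'I_N) : bool :=
  [exists K in cells D, (i \in K) && (j \in K)].
Definition pnbr (i j : 'I_N) : bool := nbr i j && (j != i).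

(* The data f, c, v and u_D are functions on all of R^d of which only the
   values on the closure of Omega, resp. on its boundary, are constrained and
   used.  Since eps > 0, the Dirichlet boundary is the whole boundary. *)
Definition admissible_data :=
  [/\ 0 < eps D,
      {within closure (Omega D), continuous (vel D)},
      {within closure (Omega D), continuous (reac D)},
      {within closure (Omega D), continuous (src D)}
    & {within bnd (Omega D), continuous (uD D)}]
  /\ (forall y, closure (Omega D) y -> 0 <= reac D y).

Definition dirichlet_numbering :=
  (Mh D <= N)%N /\ forall i : 'I_N, bnd (Omega D) (x i) <-> (Mh D <= i)%N.

Definition admissible_upwind :=
  forall i j : 'I_N, (i < Mh D)%N -> pnbr i j ->
    [/\ upwind D i j \in cells D,
        i \in upwind D i j
      & exists2 theta : R, 0 < theta &
          simplex (upwind D i j) (x i + theta *: (x i - x j))].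

End Mesh.

Section Matrices.
Variables (R : realType) (d N : nat) (D : wmc_data R d N).
Local Notation intO := (integral_on (Omega D)).

Definition aD (i j : 'I_N) : R :=
  eps D * intO (fun y => dot (grad D (phi D i) y) (grad D (phi D j) y)).
Definition aC (i j : 'I_N) : R :=
  intO (fun y => phi D i y * dot (vel D y) (grad D (phi D j) y)).
Definition aR (i j : 'I_N) : R :=
  intO (fun y => reac D y * phi D i y * phi D j y).
Definition b (i : 'I_N) : R := intO (fun y => phi D i y * src D y).
Definition aR1 (i : 'I_N) : R := \sum_(j | nbr D i j) aR i j.

Definition dcoef0 (i j : 'I_N) : R :=
  Num.max `|aC i j| (Num.max (delta D * mesh_size D ^+ d.-1) `|aC j i|).
Definition dcoef (i j : 'I_N) : R :=
  if j == i then - \sum_(k | pnbr D i k) dcoef0 i k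
  else if nbr D i j then dcoef0 i j else 0.
Definition aC1 (i : 'I_N) : R := \sum_(j | pnbr D i j) 2 * dcoef i j.

End Matrices.

Section Scheme.
Variables (R : realType) (d N : nat) (D : wmc_data R d N) (u : 'I_N -> R).
Local Notation x := (vertex D).
Local Notation v := (vel D).

Definition fe_fun (y : 'rV[R]_d) : R := \sum_j u j * phi D j y.

Definition s (i : 'I_N) : R := src D (x i) - reac D (x i) * u i.

Definition ubar (i j : 'I_N) : R :=
  (u j + u i) / 2 - aC D i j * (u j - u i) / (2 * dcoef D i j).

Definition P (i j : 'I_N) : R :=
  1 / 2 * ((s i + s j) / 2) *
  (dot (x i - x j) (v (x i) + v (x j)) /
   (2 * Num.max (enorm (v (x i))) (enorm (v (x j))) ^+ 2)).

(* The upwind value u_j^i. *)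
Definition uup (i j : 'I_N) : R :=
  u i + dot (grad_on D (upwind D i j) fe_fun) (x i - x j).

Definition Qp (i j : 'I_N) : R :=
  Num.max ((uup i j - u i) / 2)
          (Num.max (u i) (u j) - ubar i j - b D i / aC1 D i).
Definition Qm (i j : 'I_N) : R :=
  Num.min ((uup i j - u i) / 2)
          (Num.min (u i) (u j) - ubar i j - b D i / aC1 D i).

Definition Rlim (i j : 'I_N) : R :=
  if (Mh D <= i)%N then 1
  else if (b D i <= 0) && (Qp i j < P i j) then Qp i j / P i j
  else if (0 <= b D i) && (P i j < Qm i j) then Qm i j / P i j
  else 1.

Definition alpha (i j : 'I_N) : R := Num.min (Rlim i j) (Rlim j i).

Definition ubars (i j : 'I_N) : R :=
  ubar i j + alpha i j * P i j + b D i / aC1 D i.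
Definition fs (i j : 'I_N) : R :=
  2 * dcoef D i j * ((u i - u j) / 2 - alpha i j * P i j)
  + aR D i j * (u i - u j).

Definition ubarmin (i : 'I_N) : R := fmin (pnbr D i) (ubars i).
Definition ubarmax (i : 'I_N) : R := fmax (pnbr D i) (ubars i).

(* Only meaningful for i < Mh; the inner case split on j < Mh is the one
   between interior and Dirichlet neighbours. *)
Definition fstar (i j : 'I_N) : R :=
  if fs i j == 0 then 0
  else if 0 < fs i j then
    let m := Num.min (fs i j) (2 * dcoef D i j * (ubarmax i - ubars i j)) in
    if (j < Mh D)%N
    then Num.min m (2 * dcoef D i j * (ubars j i - ubarmin j)) else m
  else
    let m := Num.max (fs i j) (2 * dcoef D i j * (ubarmin i - ubars i j)) in
    if (j < Mh D)%N
    then Num.max m (2 * dcoef D i j * (ubars j i - ubarmax j)) else m.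

Definition ubarstar (i j : 'I_N) : R :=
  ubars i j + fstar i j / (2 * dcoef D i j).

Definition wmc_solution :=
  (forall i : 'I_N, (i < Mh D)%N ->
     aR1 D i * u i
     - \sum_(j | pnbr D i j)
         (2 * dcoef D i j * (ubarstar i j - u i) - aD D i j * (u j - u i)) = 0)
  /\ (forall i : 'I_N, (Mh D <= i)%N -> u i = uD D (x i)).

End Scheme.

(* The intermediate indices are the entries of the list p, which may be empty
   (i is then directly coupled to the Dirichlet index k). *)
Definition connected_to_boundary (R : realType) (d N : nat)
    (D : wmc_data R d N) :=
  forall i : 'I_N, (i < Mh D)%N ->
    exists (k : 'I_N) (p : seq 'I_N),
      [/\ (Mh D <= k)%N,
          all (fun j : 'I_N => (j < Mh D)%N) p,
          uniq (i :: rcons p k)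
        & path (fun j l => aD D j l != 0) i (rcons p k)].

(* Main.v *)
(* At a vertex where u attains its global maximum the upwind value u_j^i is at
   most u_i, so the limiter alpha keeps every bar state at most u_i, and flux
   limiting does not leave the range of the bar states.  Since phi_i >= 0, the
   reaction term has the sign of u_i, so all terms of the i-th equation have the
   same sign and vanish; in particular u_j = u_i whenever a_ij^D <> 0.  Following
   a path of nonzero diffusion couplings carries the maximum to the boundary.
   Minima are maxima of -u. *)
Require Import Defs.
From HB Require Import structures.
From mathcomp Require Import all_boot all_order all_algebra.
From mathcomp Require Import all_classical all_reals all_analysis.
From mathcomp Require Import ring lra.
Set Implicit Arguments.
Unset Strict Implicit.
Unset Printing Implicit Defensive.
Import Order.TTheory GRing.Theory Num.Theory.
Import numFieldNormedType.Exports.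
Local Open Scope classical_set_scope.
Local Open Scope ring_scope.

(** * Maxima and minima over finite index types *)

Lemma le_fmax (R : realType) (I : finType) (Q : pred I) (F : I -> R) (j : I) :
  Q j -> F j <= fmax Q F.
Proof.
move=> Qj; rewrite /fmax; case: pickP => [i0 _|/(_ j)]; last by rewrite Qj.
exact: le_bigmax_cond.
Qed.

Lemma fmax_attained (R : realType) (I : finType) (Q : pred I) (F : I -> R)
    (j : I) :
  Q j -> exists2 i, Q i & fmax Q F = F i.
Proof.
move=> Qj; rewrite /fmax; case: pickP => [i0 Qi0|/(_ j)]; last by rewrite Qj.
elim/big_ind: _ => [|y z [k Qk ->] [l Ql ->]|k Qk]; [by exists i0| |by exists k].
by rewrite /Num.max; case: ifP => _; [exists l|exists k].
Qed.

Lemma fmax_pred0 (R : realType) (I : finType) (Q : pred I) (F : I -> R) :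
  Q =1 xpred0 -> fmax Q F = 0.
Proof. by move=> Q0; rewrite /fmax; case: pickP => // i; rewrite Q0. Qed.

(** Reduces minima to maxima; the default value 0 of an empty range is its own opposite, so no
    nonemptiness condition arises. *)
Lemma fminE (R : realType) (I : finType) (Q : pred I) (F : I -> R) :
  fmin Q F = - fmax Q (fun i => - F i).
Proof.
rewrite /fmin /fmax; case: pickP => [i0 _|_]; last by rewrite oppr0.
have maxN : {morph (@GRing.opp R) : y z / Num.max y z >-> Num.min y z}.
  by move=> y z; rewrite oppr_max.
by rewrite (big_morph _ maxN (erefl _)) opprK; apply: eq_bigr => i _; rewrite opprK.
Qed.

Lemma fmin_le (R : realType) (I : finType) (Q : pred I) (F : I -> R) (j : I) :
  Q j -> fmin Q F <= F j.
Proof. by move=> Qj; rewrite fminE lerNl (le_fmax (fun i => - F i)). Qed.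

Lemma fmin_attained (R : realType) (I : finType) (Q : pred I) (F : I -> R)
    (j : I) :
  Q j -> exists2 i, Q i & fmin Q F = F i.
Proof.
move=> /(fmax_attained (fun i => - F i))[i Qi E].
by exists i => //; rewrite fminE E opprK.
Qed.

(** * Propagation of a maximum to the boundary, for an abstract scheme *)

(* All three terms of the equation have the same sign at a maximum, hence
   vanish, and the maximum spreads along nonzero entries of [A]. *)
Lemma max_at_neighbour (R : realType) (I : finType) (nb : rel I)
    (A T : I -> I -> R) (r : R) (w : I -> R) (i : I) :
  (forall j, nb i j -> A i j <= 0) ->
  (forall j, nb i j -> T i j <= 0) ->
  (forall j, w j <= w i) -> 0 <= r * w i ->
  r * w i - \sum_(j | nb i j) (T i j - A i j * (w j - w i)) = 0 ->
  forall j, nb i j -> A i j != 0 -> w j = w i.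
Proof.
move=> A_le0 T_le0 w_max rw_ge0 eqn j nij Aij.
have Aw j' : nb i j' -> 0 <= A i j' * (w j' - w i).
  by move=> n; rewrite mulr_le0 ?A_le0 // subr_le0.
have term_ge0 j' : nb i j' -> 0 <= A i j' * (w j' - w i) - T i j'.
  by move=> n; rewrite subr_ge0 (le_trans (T_le0 _ n)) ?Aw.
have sum0 : \sum_(j' | nb i j') (A i j' * (w j' - w i) - T i j') = 0.
  apply/eqP; rewrite eq_le sumr_ge0 // andbT.
  have E : \sum_(j' | nb i j') (A i j' * (w j' - w i) - T i j') =
           - \sum_(j' | nb i j') (T i j' - A i j' * (w j' - w i)).
    by rewrite -sumrN; apply: eq_bigr => j' _; rewrite opprB.
  by rewrite E; lra.
have E0 := psumr_eq0P term_ge0 sum0 nij.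
have Awj0 : A i j * (w j - w i) = 0 by have := Aw j nij; have := T_le0 j nij; lra.
by move/eqP: Awj0; rewrite mulf_eq0 (negPf Aij) subr_eq0 => /eqP.
Qed.

(** Induction on the path from [i] to the boundary: [max_at_neighbour] moves the maximum along one
    edge, and the hypotheses hold again at the new vertex because the value is the same. The sign of
    [r j * w i] is required for every row [j] since the row changes along the path while the value
    does not. *)
Lemma max_on_boundary (R : realType) (I : finType) (bd : pred I) (nb : rel I)
    (A T : I -> I -> R) (r w : I -> R) :
  (forall i j, nb i j -> A i j <= 0) ->
  (forall i, ~~ bd i -> exists (k : I) (p : seq I),
     [/\ bd k, all (fun j => ~~ bd j) p
       & path (fun j l => nb j l && (A j l != 0)) i (rcons p k)]) ->
  (forall i, ~~ bd i ->
     r i * w i - \sum_(j | nb i j) (T i j - A i j * (w j - w i)) = 0) ->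
  (forall i j, ~~ bd i -> (forall k, w k <= w i) -> nb i j -> T i j <= 0) ->
  forall i, (forall k, w k <= w i) -> (forall j, 0 <= r j * w i) ->
  exists2 k, bd k & w k = w i.
Proof.
move=> A_le0 conn eqn T_le0 i w_max rw_ge0.
have [bdi|bdi] := boolP (bd i); first by exists i.
have [k [p [bdk]]] := conn i bdi.
elim: p i bdi w_max rw_ge0 => [|j p IH] i bdi w_max rw_ge0 /= pint.
  rewrite andbT => /andP[nik Aik]; exists k => //.
  by apply: (max_at_neighbour (T := T) (r := r i)) nik Aik; auto.
case/andP: pint => bdj pint /andP[/andP[nij Aij] path_j].
have wj : w j = w i.
  by apply: (max_at_neighbour (T := T) (r := r i)) nij Aij; auto.
rewrite -wj; apply: IH => //; first by move=> l; rewrite wj.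
by move=> l; rewrite wj.
Qed.

(** A positive maximum has the right sign for [max_on_boundary]; a nonpositive one lies below the
    positive part at any boundary index. With [r = 0] the sign condition is trivial, so the maximum
    itself is attained on the boundary. [T] stays abstract so that the lemma serves both [u] and
    [-u]. *)
Lemma fmax_le_boundary (R : realType) (I : finType) (bd : pred I) (nb : rel I)
    (A T : I -> I -> R) (r w : I -> R) :
  (forall i j, nb i j -> A i j <= 0) ->
  (forall i, ~~ bd i -> exists (k : I) (p : seq I),
     [/\ bd k, all (fun j => ~~ bd j) p
       & path (fun j l => nb j l && (A j l != 0)) i (rcons p k)]) ->
  (forall i, 0 <= r i) ->
  (forall i, ~~ bd i ->
     r i * w i - \sum_(j | nb i j) (T i j - A i j * (w j - w i)) = 0) ->
  (forall i j, ~~ bd i -> (forall k, w k <= w i) -> nb i j -> T i j <= 0) ->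
  fmax xpredT w <= fmax bd (fun i => Num.max (w i) 0) /\
  ((forall i, r i = 0) -> fmax xpredT w = fmax bd w).
Proof.
move=> A_le0 conn r_ge0 eqn T_le0.
have bdry := max_on_boundary A_le0 conn eqn T_le0.
(* For an empty index type every range is empty and all the maxima are 0. *)
have [i0 _|I0] := pickP (@predT I); last first.
  by rewrite !fmax_pred0 => [//|i|i|i]; have := I0 i.
have [i _ Ei] := @fmax_attained R I xpredT w i0 isT.
have w_max k : w k <= w i by rewrite -Ei le_fmax.
split.
  rewrite Ei; have [wi_le0|wi_gt0] := leP (w i) 0; last first.
    have [j|k bdk wk] := bdry i w_max; first exact: mulr_ge0 (r_ge0 j) (ltW wi_gt0).
    apply: le_trans (le_fmax (fun l => Num.max (w l) 0) bdk).
    by rewrite wk le_max lexx.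
  have [k bdk] : exists k, bd k.
    have [bdi|/conn[k [p [bdk _ _]]]] := boolP (bd i); first by exists i.
    by exists k.
  apply: le_trans wi_le0 _; apply: le_trans (le_fmax (fun l => Num.max (w l) 0) bdk).
  by rewrite le_max lexx orbT.
move=> r0; have [j|k bdk wk] := bdry i w_max; first by rewrite r0 mul0r.
apply/eqP; rewrite eq_le; apply/andP; split; first by rewrite Ei -wk le_fmax.
by have [l _ ->] := fmax_attained w bdk; rewrite Ei.
Qed.

(** * Signs of integrals and bilinearity of [dot] *)

Lemma integral_Rd_ge0 (R : realType) (d : nat) (F : 'rV[R]_d -> R) :
  (forall y, 0 <= F y) -> 0 <= integral_Rd F.
Proof.
elim: d F => [|d IH] F F_ge0 /=; first exact: F_ge0.
by apply: Rintegral_ge0 => t _; apply: IH.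
Qed.

Lemma integral_Rd_eq0 (R : realType) (d : nat) (F : 'rV[R]_d -> R) :
  (forall y, F y = 0) -> integral_Rd F = 0.
Proof.
elim: d F => [|d IH] F F0 /=; first exact: F0.
by rewrite /Rintegral integral0_eq // => t _; rewrite IH.
Qed.

Lemma dotDr (R : realType) (d : nat) (g y z : 'rV[R]_d) :
  dot g (y + z) = dot g y + dot g z.
Proof. by rewrite /dot -big_split; apply: eq_bigr => k _; rewrite mxE mulrDr. Qed.

Lemma dotZr (R : realType) (d : nat) (g : 'rV[R]_d) (a : R) (y : 'rV[R]_d) :
  dot g (a *: y) = a * dot g y.
Proof. by rewrite /dot mulr_sumr; apply: eq_bigr => k _; rewrite mxE mulrCA. Qed.

Lemma dotBr (R : realType) (d : nat) (g y z : 'rV[R]_d) :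
  dot g (y - z) = dot g y - dot g z.
Proof. by rewrite -scaleN1r dotDr dotZr mulN1r. Qed.

Lemma dotDl (R : realType) (d : nat) (g h y : 'rV[R]_d) :
  dot (g + h) y = dot g y + dot h y.
Proof. by rewrite /dot -big_split; apply: eq_bigr => k _; rewrite mxE mulrDl. Qed.

Lemma dotZl (R : realType) (d : nat) (a : R) (g y : 'rV[R]_d) :
  dot (a *: g) y = a * dot g y.
Proof. by rewrite /dot mulr_sumr; apply: eq_bigr => k _; rewrite mxE mulrA. Qed.

Lemma dot0l (R : realType) (d : nat) (y : 'rV[R]_d) : dot 0 y = 0.
Proof. by rewrite /dot big1 // => k _; rewrite mxE mul0r. Qed.

Lemma dot0r (R : realType) (d : nat) (g : 'rV[R]_d) : dot g 0 = 0.
Proof. by rewrite /dot big1 // => k _; rewrite mxE mulr0. Qed.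

(** * Affine functions on a cell *)

Lemma simplex_vertex (R : realType) (d N : nat) (D : wmc_data R d N)
    (K : {set 'I_N}) (i : 'I_N) :
  i \in K -> simplex D K (vertex D i).
Proof.
move=> iK; exists (fun j => (j == i)%:R); split => [j _||].
- by rewrite ler0n.
- rewrite (bigD1 i) //= eqxx big1 ?addr0 // => j /andP[_ /negPf ->] //.
- rewrite (bigD1 i) //= eqxx scale1r big1 ?addr0 // => j /andP[_ /negPf ->].
  by rewrite scale0r.
Qed.

Lemma P1_on_barycentric (R : realType) (d N : nat) (D : wmc_data R d N)
    (K : {set 'I_N}) (F : 'rV[R]_d -> R) (w : 'I_N -> R) :
  P1_on D K F -> (forall i, i \in K -> 0 <= w i) -> \sum_(i in K) w i = 1 ->
  F (\sum_(i in K) w i *: vertex D i) = \sum_(i in K) w i * F (vertex D i).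
Proof.
move=> [g [c FE]] w_ge0 w1; rewrite FE; last by exists w.
(* The constant term is distributed over the vertices using that the weights sum to 1. *)
rewrite (big_morph (dot g) (dotDr g) (dot0r g)) -[c in LHS]mul1r -w1 mulr_suml.
rewrite -big_split; apply: eq_bigr => i iK /=.
by rewrite FE ?mulrDr ?dotZr //; apply: simplex_vertex.
Qed.

Lemma P1_on_grad (R : realType) (d N : nat) (D : wmc_data R d N)
    (K : {set 'I_N}) (F : 'rV[R]_d -> R) (y z : 'rV[R]_d) :
  P1_on D K F -> simplex D K y -> simplex D K z ->
  F z - F y = dot (grad_on D K F) (z - y).
Proof.
move=> [g [c FE]]; move: y z; rewrite /grad_on; set G := (X in xget 0 X).
(* [xget] returns a member of [G] once there is one; the slope of the affine representation is such
   a member. *)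
suff /(xgetPex 0) : exists g', G g' by [].
by exists g => y z Ky Kz; rewrite !FE // dotBr; ring.
Qed.

(** The matrix [M] with rows [(1, x_i)], for [i] in [K], has free rows by affine independence and is
    square, hence has full column rank. Since [dot g] is constant on the vertices, the column [h]
    made of minus that constant and [g] lies in its kernel. *)
Lemma affinely_independent_dot_eq0 (R : realType) (d N : nat)
    (D : wmc_data R d N) (K : {set 'I_N}) (g : 'rV[R]_d) :
  #|K| = d.+1 -> affinely_independent D K ->
  (forall i j, i \in K -> j \in K -> dot g (vertex D i - vertex D j) = 0) ->
  g = 0.
Proof.
move=> cardK indep g_perp.
pose M : 'M[R]_(#|K|, 1 + d) :=
  row_mx (const_mx 1) (\matrix_(r, k) vertex D (enum_val r) ord0 k).
have M_free : row_free M.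
  apply: inj_row_free => v; rewrite mul_mx_row => /eqP.
  rewrite row_mx_eq0 => /andP[/eqP v1 /eqP vX].
  (* A row vector indexed by the enumeration of [K] becomes a weight on all vertices; for a vertex
     in [K] the sum has exactly one term. *)
  pose w (i : 'I_N) : R := \sum_(r | enum_val r == i) v ord0 r.
  have wE r : w (enum_val r) = v ord0 r.
    rewrite /w (eq_bigl (pred1 r)) ?big_pred1_eq // => q /=.
    exact: (inj_eq enum_val_inj).
  apply/rowP => r; rewrite mxE -wE; apply: (indep w); last exact: enum_valP.
    rewrite big_enum_val; move/matrixP/(_ ord0 ord0): v1; rewrite !mxE => v1.
    by rewrite -[RHS]v1; apply: eq_bigr => q _; rewrite wE mxE mulr1.
  rewrite big_enum_val; apply/rowP => k; move/matrixP/(_ ord0 k): vX.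
  rewrite !mxE => vX; rewrite -[RHS]vX summxE; apply: eq_bigr => q _.
  by rewrite wE !mxE.
have M_full : row_full M by move: M_free; rewrite /row_free /row_full => /eqP ->; rewrite cardK.
have [i0 i0K] : exists i, i \in K by apply/card_gt0P; rewrite cardK.
pose h : 'cV[R]_(1 + d) := col_mx (- dot g (vertex D i0))%:M g^T.
have : M *m h = M *m 0.
  rewrite mulmx0 mul_row_col; apply/matrixP => r k; rewrite !ord1 !mxE big_ord1 !mxE.
  rewrite mul1r mulr1n addrC.
  have := g_perp _ _ (enum_valP r) i0K; rewrite dotBr => E; rewrite -[RHS]E.
  by congr (_ - _); apply: eq_bigr => k' _; rewrite !mxE mulrC.
move/(row_full_inj M_full)/eqP; rewrite col_mx_eq0 => /andP[_ /eqP gT0].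
by apply: trmx_inj; rewrite gT0 trmx0.
Qed.

(** * Signs and sparsity of the matrices *)

(** On a cell the value is a convex combination of the nodal values, which are 0 or 1. *)
Lemma phi_ge0 (R : realType) (d N : nat) (D : wmc_data R d N) (i : 'I_N)
    (y : 'rV[R]_d) :
  conforming_mesh D -> lagrange_basis D -> closure (Omega D) y ->
  0 <= phi D i y.
Proof.
move=> [_ _ _ <- _] hphi [K /= KD [w [w_ge0 w1 ->]]].
have [_ P1 phiE] := hphi i.
rewrite (P1_on_barycentric (P1 K KD)) //; apply: sumr_ge0 => j jK.
by rewrite mulr_ge0 ?w_ge0 // phiE ler0n.
Qed.

Lemma aR_ge0 (R : realType) (d N : nat) (D : wmc_data R d N) (i j : 'I_N) :
  admissible_data D -> conforming_mesh D -> lagrange_basis D -> 0 <= aR D i j.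
Proof.
move=> [_ c_ge0] hmesh hphi; apply: integral_Rd_ge0 => y.
rewrite indicE; case: (boolP (y \in Omega D)) => [|_]; last by rewrite mulr0.
rewrite inE => /subset_closure Oy.
by rewrite mulr1 !mulr_ge0 ?c_ge0 ?phi_ge0.
Qed.

Lemma aR1_ge0 (R : realType) (d N : nat) (D : wmc_data R d N) (i : 'I_N) :
  admissible_data D -> conforming_mesh D -> lagrange_basis D -> 0 <= aR1 D i.
Proof. by move=> *; apply: sumr_ge0 => j _; apply: aR_ge0. Qed.

Lemma aR1_eq0 (R : realType) (d N : nat) (D : wmc_data R d N) (i : 'I_N) :
  (forall y, Omega D y -> reac D y = 0) -> aR1 D i = 0.
Proof.
move=> c0; apply: big1 => j _; apply: integral_Rd_eq0 => y.
rewrite indicE; case: (boolP (y \in Omega D)) => [|_]; last by rewrite mulr0.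
by rewrite inE => /c0 ->; rewrite !mul0r.
Qed.

(** The basis function vanishes at all vertices of the cell, so its gradient is orthogonal to every
    edge. *)
Lemma grad_on_phi_eq0 (R : realType) (d N : nat) (D : wmc_data R d N)
    (K : {set 'I_N}) (i : 'I_N) :
  conforming_mesh D -> lagrange_basis D -> K \in cells D -> i \notin K ->
  grad_on D K (phi D i) = 0.
Proof.
move=> [_ _ /(_ K) + _ _] hphi KD iK; move=> /(_ KD)[cardK indep].
have [_ P1 phiE] := hphi i.
apply: (affinely_independent_dot_eq0 cardK indep) => j k jK kK.
rewrite -(P1_on_grad (P1 K KD)); try exact: simplex_vertex.
have ne l : l \in K -> (l == i) = false.
  by move=> lK; apply/negbTE; apply: contraNneq iK => <-.
by rewrite !phiE !ne // subrr.
Qed.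

(** Makes paths of nonzero diffusion entries run through mesh neighbours. The cell chosen by [grad]
    depends on the point only, so both gradients are taken on the same cell; without a common cell
    it misses [i] or [j], and the integrand vanishes everywhere. *)
Lemma aD_neq0_nbr (R : realType) (d N : nat) (D : wmc_data R d N) (i j : 'I_N) :
  conforming_mesh D -> lagrange_basis D -> aD D i j != 0 -> nbr D i j.
Proof.
move=> hmesh hphi; apply: contraNT => /exists_inPn not_nbr.
rewrite /aD [integral_on _ _]integral_Rd_eq0 ?mulr0 // => y.
suff -> : dot (grad D (phi D i) y) (grad D (phi D j) y) = 0 by rewrite mul0r.
rewrite /grad; case: pickP => [K /andP[KD _]|_]; last by rewrite dot0l.
have := not_nbr K KD; rewrite negb_and => /orP[iK|jK].
  by rewrite grad_on_phi_eq0 // dot0l.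
by rewrite (grad_on_phi_eq0 _ _ _ jK) // dot0r.
Qed.

(** * The finite element function and its upwind values *)

Lemma P1_on_fe_fun (R : realType) (d N : nat) (D : wmc_data R d N)
    (u : 'I_N -> R) (K : {set 'I_N}) :
  lagrange_basis D -> K \in cells D -> P1_on D K (fe_fun D u).
Proof.
move=> hphi KD.
(* The sum is unfolded so that the induction can run over an arbitrary list of summation indices. *)
suff [g [c H]] : exists (g : 'rV[R]_d) (c : R), forall y, simplex D K y ->
    \sum_j u j * phi D j y = dot g y + c by exists g, c.
elim: (index_enum _) => [|j l [g [c IH]]].
  by exists 0, 0 => y _; rewrite big_nil dot0l addr0.
have [_ /(_ K KD)[g' [c' phiE]] _] := hphi j.
exists (u j *: g' + g), (u j * c' + c) => y Ky.
by rewrite big_cons IH // phiE // dotDl dotZl; ring.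
Qed.

Lemma fe_fun_vertex (R : realType) (d N : nat) (D : wmc_data R d N)
    (u : 'I_N -> R) (i : 'I_N) :
  lagrange_basis D -> fe_fun D u (vertex D i) = u i.
Proof.
move=> hphi; rewrite /fe_fun (bigD1 i) //=.
have [_ _ ->] := hphi i; rewrite eqxx mulr1 big1 ?addr0 // => j /negPf ji.
by have [_ _ ->] := hphi j; rewrite eq_sym ji mulr0.
Qed.

(* The half line behind [x_i] meets the upwind cell at a convex combination
   of its vertices, where the finite element function has the value
   [u_i + theta (u_j^i - u_i)]. *)
Lemma uup_convex (R : realType) (d N : nat) (D : wmc_data R d N)
    (u : 'I_N -> R) (i j : 'I_N) :
  lagrange_basis D -> admissible_upwind D -> (i < Mh D)%N -> pnbr D i j ->
  exists2 theta : R, 0 < theta & exists2 w : 'I_N -> R,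
    forall k, k \in upwind D i j -> 0 <= w k &
    theta * (uup D u i j - u i) = \sum_(k in upwind D i j) w k * (u k - u i).
Proof.
move=> hphi hup iM nij; have [KD iK [theta theta_gt0 zK]] := hup i j iM nij.
exists theta => //; have FP1 := P1_on_fe_fun u hphi KD.
have gradE := P1_on_grad FP1 (simplex_vertex D iK) zK.
case: zK => w [w_ge0 w1 zE]; exists w => //.
move: gradE; rewrite addrAC subrr add0r dotZr fe_fun_vertex // => gradE.
rewrite /uup [u i + _]addrC addrK -gradE.
rewrite zE P1_on_barycentric // -[u i in LHS]mul1r -w1 mulr_suml -sumrB.
by apply: eq_bigr => k _; rewrite fe_fun_vertex // mulrBr.
Qed.

Lemma uup_le (R : realType) (d N : nat) (D : wmc_data R d N) (u : 'I_N -> R)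
    (i j : 'I_N) :
  lagrange_basis D -> admissible_upwind D -> (i < Mh D)%N -> pnbr D i j ->
  (forall k, u k <= u i) -> uup D u i j <= u i.
Proof.
move=> hphi hup iM nij u_max.
have [t t_gt0 [w w_ge0 E]] := uup_convex u hphi hup iM nij.
rewrite -subr_le0 -(pmulr_rle0 _ t_gt0) E; apply: sumr_le0 => k kK.
by rewrite mulr_ge0_le0 ?w_ge0 // subr_le0.
Qed.

Lemma uup_ge (R : realType) (d N : nat) (D : wmc_data R d N) (u : 'I_N -> R)
    (i j : 'I_N) :
  lagrange_basis D -> admissible_upwind D -> (i < Mh D)%N -> pnbr D i j ->
  (forall k, u i <= u k) -> u i <= uup D u i j.
Proof.
move=> hphi hup iM nij u_min.
have [t t_gt0 [w w_ge0 E]] := uup_convex u hphi hup iM nij.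
rewrite -subr_ge0 -(pmulr_rge0 _ t_gt0) E; apply: sumr_ge0 => k kK.
by rewrite mulr_ge0 ?w_ge0 // subr_ge0.
Qed.

(** * Bounds on the bar states and on the limiter [alpha] *)

Lemma dcoef_pnbr (R : realType) (d N : nat) (D : wmc_data R d N) (i j : 'I_N) :
  pnbr D i j -> dcoef D i j = dcoef0 D i j.
Proof. by rewrite /pnbr /dcoef => /andP[-> /negPf ->]. Qed.

Lemma norm_aC_le_dcoef (R : realType) (d N : nat) (D : wmc_data R d N)
    (i j : 'I_N) :
  pnbr D i j -> `|aC D i j| <= dcoef D i j.
Proof. by move=> /dcoef_pnbr ->; rewrite le_max lexx. Qed.

Lemma dcoef_ge0 (R : realType) (d N : nat) (D : wmc_data R d N) (i j : 'I_N) :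
  pnbr D i j -> 0 <= dcoef D i j.
Proof. by move=> /norm_aC_le_dcoef; apply: le_trans. Qed.

Lemma aC1_ge0 (R : realType) (d N : nat) (D : wmc_data R d N) (i : 'I_N) :
  0 <= aC1 D i.
Proof. by apply: sumr_ge0 => j /dcoef_ge0 d_ge0; rewrite mulr_ge0. Qed.

(** With [t = a_ij^C / d_ij], the bar state has weights [(1 + t) / 2] and [(1 - t) / 2]; these are
    nonnegative because [d_ij] dominates [|a_ij^C|]. *)
Lemma ubar_bounds (R : realType) (d N : nat) (D : wmc_data R d N)
    (u : 'I_N -> R) (i j : 'I_N) :
  pnbr D i j ->
  Num.min (u i) (u j) <= ubar D u i j <= Num.max (u i) (u j).
Proof.
move=> nij; pose t := aC D i j / dcoef D i j.
have : `|t| <= 1.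
  rewrite normrM normfV [`|dcoef _ _ _|]ger0_norm ?dcoef_ge0 //.
  (* For a zero denominator the quotient is 0 by convention. *)
  have [->|d_gt0] := eqVneq (dcoef D i j) 0; first by rewrite invr0 mulr0.
  by rewrite ler_pdivrMr ?mul1r ?norm_aC_le_dcoef // lt0r d_gt0 dcoef_ge0.
rewrite ler_norml => /andP[t_ge t_le].
have -> : ubar D u i j = (1 + t) / 2 * u i + (1 - t) / 2 * u j.
  (* The inverse of [d_ij] is generalized to [e], so that [field] has only the constant 2 to
     invert. *)
  by rewrite /ubar /t invfM; move: (dcoef D i j)^-1 => e; field.
by rewrite /Num.min /Num.max; case: ltP => uij; apply/andP; split; nra.
Qed.

(** The second entry of the maximum is already nonnegative, by [ubar_bounds] and the sign of
    [b_i]. *)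
Lemma Qp_ge0 (R : realType) (d N : nat) (D : wmc_data R d N) (u : 'I_N -> R)
    (i j : 'I_N) :
  pnbr D i j -> b D i <= 0 -> 0 <= Qp D u i j.
Proof.
move=> /(ubar_bounds u)/andP[_ ub] b_le0; rewrite le_max; apply/orP; right.
have : b D i / aC1 D i <= 0 by rewrite mulr_le0_ge0 // invr_ge0 aC1_ge0.
lra.
Qed.

Lemma Qm_le0 (R : realType) (d N : nat) (D : wmc_data R d N) (u : 'I_N -> R)
    (i j : 'I_N) :
  pnbr D i j -> 0 <= b D i -> Qm D u i j <= 0.
Proof.
move=> /(ubar_bounds u)/andP[lb _] b_ge0; rewrite ge_min; apply/orP; right.
have : 0 <= b D i / aC1 D i by rewrite mulr_ge0 // invr_ge0 aC1_ge0.
lra.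
Qed.

(** Where the limiter acts, either [0 <= Qp < P] or [P < Qm <= 0], so the quotient has nonnegative
    sign and, as the next lemma shows, does not exceed 1. *)
Lemma Rlim_ge0 (R : realType) (d N : nat) (D : wmc_data R d N) (u : 'I_N -> R)
    (i j : 'I_N) :
  pnbr D i j -> 0 <= Rlim D u i j.
Proof.
move=> nij; rewrite /Rlim; case: ifP => // _.
case: ifP => [/andP[/(Qp_ge0 u nij) Q_ge0 QP]|_].
  by rewrite mulr_ge0 // invr_ge0; lra.
case: ifP => [/andP[/(Qm_le0 u nij) Q_le0 PQ]|//].
by rewrite mulr_le0 // invr_le0; lra.
Qed.

Lemma Rlim_le1 (R : realType) (d N : nat) (D : wmc_data R d N) (u : 'I_N -> R)
    (i j : 'I_N) :
  pnbr D i j -> Rlim D u i j <= 1.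
Proof.
move=> nij; rewrite /Rlim; case: ifP => // _.
case: ifP => [/andP[/(Qp_ge0 u nij) Q_ge0 QP]|_].
  by rewrite ler_pdivrMr ?mul1r; lra.
case: ifP => [/andP[/(Qm_le0 u nij) Q_le0 PQ]|//].
by rewrite ler_ndivrMr ?mul1r; lra.
Qed.

Lemma pnbrC (R : realType) (d N : nat) (D : wmc_data R d N) (i j : 'I_N) :
  pnbr D i j = pnbr D j i.
Proof.
rewrite /pnbr /nbr eq_sym; congr (_ && _).
by apply: eq_existsb => K; rewrite [(i \in K) && _]andbC.
Qed.

Lemma alpha_bounds (R : realType) (d N : nat) (D : wmc_data R d N)
    (u : 'I_N -> R) (i j : 'I_N) :
  pnbr D i j -> 0 <= alpha D u i j <= 1.
Proof.
move=> nij; have nji : pnbr D j i by rewrite pnbrC.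
by rewrite le_min ge_min !Rlim_ge0 ?Rlim_le1.
Qed.

(** If [P <= Qp], scaling by a factor in [[0, 1]] keeps the bound because [Qp >= 0]. Otherwise
    [alpha] is at most [Rlim i j = Qp / P], which is chosen to give equality. *)
Lemma alphaP_le_Qp (R : realType) (d N : nat) (D : wmc_data R d N)
    (u : 'I_N -> R) (i j : 'I_N) :
  (i < Mh D)%N -> pnbr D i j -> b D i <= 0 ->
  alpha D u i j * P D u i j <= Qp D u i j.
Proof.
move=> iM nij b_le0; have Q_ge0 := Qp_ge0 u nij b_le0.
have /andP[a_ge0 a_le1] := alpha_bounds u nij.
have [PQ|QP] := leP (P D u i j) (Qp D u i j); first by nra.
rewrite -ler_pdivlMr; last by lra.
by rewrite /alpha ge_min /Rlim leqNgt iM b_le0 QP lexx.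
Qed.

Lemma Qm_le_alphaP (R : realType) (d N : nat) (D : wmc_data R d N)
    (u : 'I_N -> R) (i j : 'I_N) :
  (i < Mh D)%N -> pnbr D i j -> 0 <= b D i ->
  Qm D u i j <= alpha D u i j * P D u i j.
Proof.
move=> iM nij b_ge0; have Q_le0 := Qm_le0 u nij b_ge0.
have /andP[a_ge0 a_le1] := alpha_bounds u nij.
have [QP|PQ] := leP (Qm D u i j) (P D u i j); first by nra.
have P_lt0 : P D u i j < 0 by lra.
rewrite -ler_ndivlMr // /alpha ge_min /Rlim leqNgt iM b_ge0 PQ /=.
(* When [b_i = 0], [Rlim] tests the upper bound first; that branch would force [P > Qp >= 0],
   against [P < 0]. *)
case: ifP => [/andP[/(Qp_ge0 u nij) ? ?]|_]; [by lra|by rewrite lexx].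
Qed.

(** One of the two entries of [Qp] bounds [alpha P]. The first is nonpositive at a maximum by
    [uup_le], and then [ubar] and the sign of [b_i] suffice; the second is exactly the room left
    between the unlimited state with source and [u_i]. *)
Lemma ubars_le_max (R : realType) (d N : nat) (D : wmc_data R d N)
    (u : 'I_N -> R) (i j : 'I_N) :
  lagrange_basis D -> admissible_upwind D -> (i < Mh D)%N -> b D i <= 0 ->
  (forall k, u k <= u i) -> pnbr D i j -> ubars D u i j <= u i.
Proof.
move=> hphi hup iM b_le0 u_max nij.
have := alphaP_le_Qp u iM nij b_le0; rewrite /Qp /ubars.
have /andP[_] := ubar_bounds u nij; rewrite max_l //.
have := uup_le hphi hup iM nij u_max.
have : b D i / aC1 D i <= 0 by rewrite mulr_le0_ge0 // invr_ge0 aC1_ge0.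
by rewrite le_max => ? ? ? /orP[]; lra.
Qed.

Lemma min_le_ubars (R : realType) (d N : nat) (D : wmc_data R d N)
    (u : 'I_N -> R) (i j : 'I_N) :
  lagrange_basis D -> admissible_upwind D -> (i < Mh D)%N -> 0 <= b D i ->
  (forall k, u i <= u k) -> pnbr D i j -> u i <= ubars D u i j.
Proof.
move=> hphi hup iM b_ge0 u_min nij.
have := Qm_le_alphaP u iM nij b_ge0; rewrite /Qm /ubars.
have /andP[+ _] := ubar_bounds u nij; rewrite min_l //.
have := uup_ge hphi hup iM nij u_min.
have : 0 <= b D i / aC1 D i by rewrite mulr_ge0 // invr_ge0 aC1_ge0.
by rewrite ge_min => ? ? ? /orP[]; lra.
Qed.

(** * Flux limiting stays within the range of the bar states *)

(** A positive flux is a minimum of nonnegative quantities, one of which is the upper bound, and the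
    lower bound is nonpositive; a negative flux is symmetric. The quantities taken from row [j] have
    the right sign because [ubars j i] is one of the bar states of [j]. *)
Lemma fstar_bounds (R : realType) (d N : nat) (D : wmc_data R d N)
    (u : 'I_N -> R) (i j : 'I_N) :
  pnbr D i j ->
  2 * dcoef D i j * (ubarmin D u i - ubars D u i j) <= fstar D u i j
    <= 2 * dcoef D i j * (ubarmax D u i - ubars D u i j).
Proof.
move=> nij; have nji : pnbr D j i by rewrite pnbrC.
have dij_ge0 : 0 <= 2 * dcoef D i j by rewrite mulr_ge0 ?dcoef_ge0.
have maxi : ubars D u i j <= ubarmax D u i by exact: le_fmax.
have mini : ubarmin D u i <= ubars D u i j by exact: fmin_le.
have maxj : ubars D u j i <= ubarmax D u j by exact: le_fmax.
have minj : ubarmin D u j <= ubars D u j i by exact: fmin_le.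
have hi_i : 0 <= 2 * dcoef D i j * (ubarmax D u i - ubars D u i j).
  by rewrite mulr_ge0 // subr_ge0.
have lo_i : 2 * dcoef D i j * (ubarmin D u i - ubars D u i j) <= 0.
  by rewrite mulr_ge0_le0 // subr_le0.
have hi_j : 0 <= 2 * dcoef D i j * (ubars D u j i - ubarmin D u j).
  by rewrite mulr_ge0 // subr_ge0.
have lo_j : 2 * dcoef D i j * (ubars D u j i - ubarmax D u j) <= 0.
  by rewrite mulr_ge0_le0 // subr_le0.
rewrite /fstar; have [fs_lt0|fs_gt0|_] := ltgtP (fs D u i j) 0; last by rewrite lo_i hi_i.
- have le0 : fs D u i j <= 0 by apply: ltW.
  by case: ifP => _; rewrite !le_max !ge_max lexx ?orbT /= !(le_trans _ hi_i).
- have ge0 : 0 <= fs D u i j by apply: ltW.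
  by case: ifP => _; rewrite !le_min !ge_min lexx ?orbT ?andbT /= !(le_trans lo_i).
Qed.

Lemma ubarstar_bounds (R : realType) (d N : nat) (D : wmc_data R d N)
    (u : 'I_N -> R) (i j : 'I_N) :
  pnbr D i j -> ubarmin D u i <= ubarstar D u i j <= ubarmax D u i.
Proof.
move=> nij; have := fstar_bounds u nij; rewrite /ubarstar.
(* If [d_ij = 0], the correction is a division by zero, hence 0, and the limited state is [ubars]
   itself. *)
have [d0|d_neq0] := eqVneq (dcoef D i j) 0.
  rewrite d0 mulr0 invr0 mulr0 addr0 => _.
  by rewrite fmin_le ?le_fmax.
have d_gt0 : 0 < 2 * dcoef D i j by rewrite mulr_gt0 // lt0r d_neq0 dcoef_ge0.
move=> /andP[lo hi]; apply/andP; split.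
  by rewrite -lerBlDl ler_pdivlMr // mulrC.
by rewrite -lerBrDl ler_pdivrMr // mulrC.
Qed.

Lemma ubarstar_le_max (R : realType) (d N : nat) (D : wmc_data R d N)
    (u : 'I_N -> R) (i j : 'I_N) :
  lagrange_basis D -> admissible_upwind D -> (i < Mh D)%N -> b D i <= 0 ->
  (forall k, u k <= u i) -> pnbr D i j -> ubarstar D u i j <= u i.
Proof.
move=> hphi hup iM b_le0 u_max nij.
have /andP[_ /le_trans] := ubarstar_bounds u nij; apply.
by have [k nik] := fmax_attained (ubars D u i) nij; rewrite /ubarmax => ->;
   apply: ubars_le_max.
Qed.

Lemma min_le_ubarstar (R : realType) (d N : nat) (D : wmc_data R d N)
    (u : 'I_N -> R) (i j : 'I_N) :
  lagrange_basis D -> admissible_upwind D -> (i < Mh D)%N -> 0 <= b D i ->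
  (forall k, u i <= u k) -> pnbr D i j -> u i <= ubarstar D u i j.
Proof.
move=> hphi hup iM b_ge0 u_min nij.
have /andP[+ _] := ubarstar_bounds u nij; apply: le_trans.
by have [k nik] := fmin_attained (ubars D u i) nij; rewrite /ubarmin => ->;
   apply: min_le_ubars.
Qed.

(** * Application to the scheme *)

(** Distinctness of the indices makes consecutive ones differ, so each nonzero entry on the path is
    off-diagonal and [aD_neq0_nbr] yields a proper neighbour. *)
Lemma connected_pnbr (R : realType) (d N : nat) (D : wmc_data R d N) :
  conforming_mesh D -> lagrange_basis D -> connected_to_boundary D ->
  forall i : 'I_N, ~~ (Mh D <= i)%N -> exists (k : 'I_N) (p : seq 'I_N),
    [/\ (Mh D <= k)%N, all (fun j : 'I_N => ~~ (Mh D <= j)%N) p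
      & path (fun j l => pnbr D j l && (aD D j l != 0)) i (rcons p k)].
Proof.
move=> hmesh hphi hconn i; rewrite -ltnNge => /hconn[k [p [kM pM uniq_p path_p]]].
exists k, p; split => //; first by apply: sub_all pM => j; rewrite ltnNge.
elim: (rcons p k) i uniq_p path_p => //= j q IH i /andP[+ /IH{}IH].
rewrite inE negb_or eq_sym => /andP[ji _] /andP[aij /IH ->].
by rewrite /pnbr (aD_neq0_nbr hmesh hphi aij) ji aij.
Qed.

Theorem theorem3 (R : realType) (d N : nat) (D : wmc_data R d N)
    (hd : (1 <= d <= 3)%N)
    (hOmega : bounded_lipschitz_domain (Omega D))
    (hdata : admissible_data D)
    (hmesh : conforming_mesh D)
    (hphi : lagrange_basis D)
    (hDir : dirichlet_numbering D)
    (hdelta : 0 < delta D)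
    (hup : admissible_upwind D)
    (haD : forall i j : 'I_N, i != j -> aD D i j <= 0)
    (hvel : forall i j : 'I_N, pnbr D i j ->
       0 < enorm (vel D (vertex D i)) + enorm (vel D (vertex D j)))
    (hconn : connected_to_boundary D)
    (u : 'I_N -> R)
    (hu : wmc_solution D u) :
  [/\ (forall i : 'I_N, (i < Mh D)%N -> b D i <= 0) ->
        fmax xpredT u
        <= fmax (fun i : 'I_N => (Mh D <= i)%N) (fun i => Num.max (u i) 0),
      (forall i : 'I_N, (i < Mh D)%N -> 0 <= b D i) ->
        fmin (fun i : 'I_N => (Mh D <= i)%N) (fun i => Num.min (u i) 0)
        <= fmin xpredT u
    & (forall y, Omega D y -> reac D y = 0) ->
      ((forall i : 'I_N, (i < Mh D)%N -> b D i <= 0) ->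
         fmax xpredT u = fmax (fun i : 'I_N => (Mh D <= i)%N) u) /\
      ((forall i : 'I_N, (i < Mh D)%N -> 0 <= b D i) ->
         fmin xpredT u = fmin (fun i : 'I_N => (Mh D <= i)%N) u)].
Proof.
have nbr_aD i j : pnbr D i j -> aD D i j <= 0.
  by case/andP => _ ji; rewrite haD // eq_sym.
have conn := connected_pnbr hmesh hphi hconn.
have r_ge0 i : 0 <= aR1 D i by apply: aR1_ge0.
have [eqn _] := hu.
pose bd (i : 'I_N) := (Mh D <= i)%N.
have upper : (forall i : 'I_N, (i < Mh D)%N -> b D i <= 0) ->
    fmax xpredT u <= fmax bd (fun i => Num.max (u i) 0) /\
    ((forall i, aR1 D i = 0) -> fmax xpredT u = fmax bd u).
  move=> b_le0; apply: fmax_le_boundary nbr_aD conn r_ge0 _ _.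
    by move=> i; rewrite -ltnNge; apply: eqn.
  move=> i j; rewrite -ltnNge => iM u_max nij /=.
  have ub := ubarstar_le_max hphi hup iM (b_le0 i iM) u_max nij.
  by rewrite mulr_ge0_le0 ?mulr_ge0 ?dcoef_ge0 ?subr_le0.
(* The opposite of each equation is an equation of the same form for [w], with the same [aR1] and
   [aD] and with the convective term [T] negated. *)
pose w i := - u i.
have lower : (forall i : 'I_N, (i < Mh D)%N -> 0 <= b D i) ->
    fmax xpredT w <= fmax bd (fun i => Num.max (w i) 0) /\
    ((forall i, aR1 D i = 0) -> fmax xpredT w = fmax bd w).
  move=> b_ge0; apply: (fmax_le_boundary
    (T := fun i j => - (2 * dcoef D i j * (ubarstar D u i j - u i)))
    nbr_aD conn r_ge0).
    move=> i; rewrite -ltnNge => /eqn E; rewrite mulrN -opprD.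
    apply/eqP; rewrite oppr_eq0 -[X in _ == X]E; apply/eqP; congr (_ + _).
    by rewrite -sumrN; apply: eq_bigr => j _; rewrite /w; ring.
  move=> i j; rewrite -ltnNge => iM w_max nij /=; rewrite oppr_le0.
  have u_min k : u i <= u k by rewrite -lerN2; apply: w_max.
  have lb := min_le_ubarstar hphi hup iM (b_ge0 i iM) u_min nij.
  by rewrite !mulr_ge0 ?dcoef_ge0 ?subr_ge0.
have min0E : (fun i => - Num.min (u i) 0) = (fun i => Num.max (w i) 0).
  by apply/funext => i; rewrite oppr_min oppr0.
split=> [/upper[]//|/lower[]|c0].
  by rewrite !fminE min0E lerN2.
have r0 i : aR1 D i = 0 by apply: aR1_eq0.
split=> [/upper[_]|/lower[_]]; first exact.
by rewrite !fminE => /(_ r0) ->.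
Qed.
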